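(* We have $\mathcal{F}(\mathsf{Cov})\subseteq\mathcal{F}(\mathsf{Div})$.
   Context: A $k$-graph is a $k$-uniform hypergraph on a finite vertex set. For $\varepsilon,d>0$, an $n$-vertex $k$-graph $G$ is uniformly $(\varepsilon,d)$-dense if for all (not necessarily disjoint) $X_1,\dots,X_k\subseteq V(G)$ we have $e_G(X_1,\dots,X_k)\geq d|X_1|\cdots|X_k|-\varepsilon n^k$, where $e_G(X_1,\dots,X_k)$ is the number of tuples $(v_1,\dots,v_k)\in X_1\times\dots\times X_k$ with $\{v_1,\dots,v_k\}$ an edge of $G$. $\mathsf{UniDen}_{\varepsilon,d}$ is the set of all uniformly $(\varepsilon,d)$-dense $k$-graphs, for all $k\geq2$. $\mathsf{MinDeg}_{1,\mu}$ is the set of all $k$-graphs $G$ ($k\geq2$) with every vertex in at least $\mu\binom{|V(G)|-1}{k-1}$ edges. An $m$-digraph $H$ has a finite vertex set $V(H)$ and edge set $E(H)\subseteq V(H)^m$ (repeated entries allowed); $\mathrm{m}(v,e)=|\{i:e(i)=v\}|$. For $k$-graphs $F,G$ with $V(F)=\{1,\dots,m\}$, $H(F;G)$ is the $m$-digraph on $V(G)$ with an edge $(\phi(1),\dots,\phi(m))$ for every homomorphism $\phi$ (map $V(F)\to V(G)$ sending edges to edges). $\mathsf{Div}$ is the set of digraphs $H$ admitting $w\colon E(H)\to\mathbb{Z}$ with $\sum_{e\in H}w(e)\,\mathrm{m}(v,e)=1$ for all $v\in V(H)$; $\mathsf{Cov}$ is the set of digraphs in which every vertex $v$ has an edge $e$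 with $\mathrm{m}(v,e)=1$. For $\mathsf{X}\in\{\mathsf{Div},\mathsf{Cov}\}$, $\mathcal{F}(\mathsf{X})$ contains, for every $k\geq2$, the $k$-graphs $F$ such that for every $d,\mu>0$ there is $\varepsilon>0$ such that for every $n$ large enough divisible by $v(F)$, every $n$-vertex $k$-graph $G\in\mathsf{UniDen}_{\varepsilon,d}\cap\mathsf{MinDeg}_{1,\mu}$ satisfies $H(F;G)\in\mathsf{X}$. *)

(* Defs.v *)
From mathcomp Require Import all_boot all_order all_algebra reals.

Set Implicit Arguments.
Unset Strict Implicit.
Unset Printing Implicit Defensive.

Import Order.TTheory GRing.Theory Num.Theory.

Local Open Scope ring_scope.

Record kgraph (k : nat) (V : finType) := KGraph {
  edges : {set {set V}};
  edges_uniform : forall e : {set V}, e \in edges -> #|e| = k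
}.

(* [X i] is $X_{i+1}$; the count is over ordered tuples, not over edges. *)
Definition num_edge_tuples k (V : finType) (G : kgraph k V)
    (X : 'I_k -> {set V}) : nat :=
  #|[set v : {ffun 'I_k -> V} |
      [forall i, v i \in X i] && ([set v i | i : 'I_k] \in edges G)]|.

Definition UniDen (R : realType) (eps d : R) k (V : finType)
    (G : kgraph k V) : Prop :=
  forall X : 'I_k -> {set V},
    d * \prod_(i < k) #|X i|%:R - eps * #|V|%:R ^+ k
      <= (num_edge_tuples G X)%:R.

Definition degree k (V : finType) (G : kgraph k V) (v : V) : nat :=
  #|[set e in edges G | v \in e]|.

Definition MinDeg1 (R : realType) (mu : R) k (V : finType)
    (G : kgraph k V) : Prop :=
  forall v : V, mu * 'C(#|V|.-1, k.-1)%:R <= (degree G v)%:R.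

(* An m-digraph on V is its edge set; an element of V^m is a finite function
   on 'I_m, so repeated entries are allowed. *)
Definition digraph (m : nat) (V : finType) := {set {ffun 'I_m -> V}}.

Definition mult m (V : finType) (v : V) (e : {ffun 'I_m -> V}) : nat :=
  #|[set i | e i == v]|.

Definition is_hom k m (V : finType) (F : kgraph k 'I_m) (G : kgraph k V)
    (phi : {ffun 'I_m -> V}) : bool :=
  [forall e in edges F, phi @: (e : {set 'I_m}) \in edges G].

(* A homomorphism is identified with its tuple of values. *)
Definition hom_digraph k m (V : finType) (F : kgraph k 'I_m)
    (G : kgraph k V) : digraph m V :=
  [set phi : {ffun 'I_m -> V} | is_hom F G phi].

Definition digraph_class := forall (m : nat) (V : finType), digraph m V -> Prop.

(* Only the values of w on the edges of H matter. *)
Definition Div : digraph_class := fun m V H =>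
  exists w : {ffun 'I_m -> V} -> int,
    forall v : V, \sum_(e in H) w e * (mult v e)%:Z = 1.

Definition Cov : digraph_class := fun m V H =>
  forall v : V, exists2 e : {ffun 'I_m -> V}, e \in H & mult v e = 1%N.

(* Membership of the k-graph F on {0, ..., m-1} in $\mathcal{F}(X)$. The
   uniformity k is part of the type of F, so that an edgeless F is considered
   separately for each k. *)
Definition in_family (R : realType) (X : digraph_class) k m
    (F : kgraph k 'I_m) : Prop :=
  forall d mu : R, 0 < d -> 0 < mu ->
  exists2 eps : R, 0 < eps &
  exists n0 : nat, forall n : nat, (n0 <= n)%N -> (m %| n)%N ->
  forall (V : finType) (G : kgraph k V), #|V| = n ->
    UniDen eps d G -> MinDeg1 mu G -> X m V (hom_digraph F G).

(* Main.v *)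
(* Let L be the lattice spanned by the vectors [\sum_i delta (phi i)] over the
   homomorphisms phi from F to G, and call u, v equivalent if
   [delta v - delta u] is in L.  Restricting G to a large vertex set W and
   thinning out the edges at a single vertex v preserves uniform density;
   deleting the few vertices of low degree and up to m more to restore
   divisibility then also gives minimum degree, so F in F(Cov) yields a
   homomorphism into v |: W that uses v exactly once, through prescribed edges.
   - If the links of u and v share a positive proportion of (k-1)-sets, keep at
     v only the edges that stay edges when v is exchanged with u: swapping v
     for u in the homomorphism shows that u and v are equivalent.  By averaging,
     some u has such a large common link with linearly many v, forming X.
   - A vertex v of large degree into X satisfies
     [delta v = - (m - 1) delta u] modulo L.  By uniform density this holds for
     all v outside a small set B, in particular for some v in X, so that
     [m delta u] is in L and all vertices outside B are equivalent to u.
   - As B is small, every vertex has large degree into its complement, hence is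
     equivalent to u as well.
   Finally [\sum_v delta v = n delta u = (n / m) m delta u = 0] modulo L. *)
Require Import Defs.
From mathcomp Require Import all_boot all_order all_algebra reals.
From mathcomp Require Import lra ring zify.

Set Implicit Arguments.
Unset Strict Implicit.
Unset Printing Implicit Defensive.

Import Order.TTheory GRing.Theory Num.Theory.

Local Open Scope ring_scope.

(** * Elementary bounds for binomial coefficients and unions *)

Lemma bin_leq_expn (n j : nat) : ('C(n, j) <= n ^ j)%N.
Proof.
apply: (@leq_trans (n ^_ j)); first by rewrite -bin_ffact leq_pmulr ?fact_gt0.
rewrite ffact_prod -[j in (n ^ j)%N]card_ord -prod_nat_const.
by apply: leq_prod => i _; apply: leq_subr.
Qed.

(** Each of the [j] factors [n.-1 - i] of the falling factorial is at least [n / 2]. This turns the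
    binomial degree condition into a bound of order [n ^ j]. *)
Lemma expn_leq_bin (n j : nat) :
  (j.*2 <= n)%N -> (n ^ j <= 2 ^ j * j`! * 'C(n.-1, j))%N.
Proof.
move=> jn; rewrite -mulnA [(j`! * _)%N]mulnC bin_ffact ffact_prod.
rewrite -[j in (n ^ j)%N]card_ord -[j in (2 ^ j)%N]card_ord -!prod_nat_const.
rewrite -big_split /=; apply: leq_prod => i _.
by have := ltn_ord i; lia.
Qed.

Lemma card_bigcup_leq (T I : finType) (P : pred I) (D : I -> {set T}) :
  (#|\bigcup_(i | P i) D i| <= \sum_(i | P i) #|D i|)%N.
Proof.
elim/big_ind2: _ => [|A a B b Aa Bb|//]; first by rewrite cards0.
by apply: leq_trans (leq_card_setU _ _) _; apply: leq_add.
Qed.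

(** * Counting edges at a vertex of a uniform hypergraph *)

Section UniformHypergraph.
Variables (k : nat) (V : finType) (G : kgraph k.+2 V).

Lemma card_edges_pair (x b : V) :
  x != b -> (#|[set e in edges G | (x \in e) && (b \in e)]| <= #|V| ^ k)%N.
Proof.
move=> xb; apply: leq_trans (bin_leq_expn _ _); set A := [set e in _ | _].
rewrite -card_draws -(@card_in_imset _ _ (fun e : {set V} => e :\ x :\ b) A); last first.
  move=> e f; rewrite !inE => /and3P[_ xe be] /and3P[_ xf bf] ef.
  by rewrite -(setD1K xe) -(setD1K xf) -(@setD1K _ b (e :\ x)) ?ef ?setD1K ?inE 1?eq_sym ?xb.
apply/subset_leq_card/subsetP => _ /imsetP[e + ->]; rewrite !inE => /and3P[eG xe be].
have := edges_uniform eG.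
by rewrite (cardsD1 x) xe (cardsD1 b) !inE be [b == x]eq_sym xb => /eqP.
Qed.

(** Union bound over the pairs [x], [b]. It makes avoiding few vertices cheap: if [#|B|] is a small
    fraction of [#|V|], then [x] loses at most that fraction of [#|V| ^ k.+1] edges. *)
Lemma card_edges_meeting (x : V) (B : {set V}) :
  (#|[set e in edges G | (x \in e) && ~~ [disjoint e & B :\ x]]|
     <= #|B| * #|V| ^ k)%N.
Proof.
set A := [set e in _ | _].
have AS : A \subset \bigcup_(b in B :\ x) [set e in edges G | (x \in e) && (b \in e)].
  apply/subsetP => e; rewrite inE => /and3P[eG xe /pred0Pn[b /andP[/= be bB]]].
  by apply/bigcupP; exists b => //; rewrite inE eG xe be.
apply: leq_trans (subset_leq_card AS) _; apply: leq_trans (card_bigcup_leq _ _) _.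
apply: (@leq_trans (\sum_(b in B :\ x) #|V| ^ k)%N).
  by apply: leq_sum => b; rewrite !inE eq_sym => /andP[xb _]; apply: card_edges_pair.
by rewrite sum_nat_const leq_mul2r subset_leq_card ?subD1set ?orbT.
Qed.

Definition degree_into (W : {set V}) (v : V) : nat :=
  #|[set e in edges G | (v \in e) && (e \subset v |: W)]|.

(** Sort the tuples by their first entry [v] and their edge [e]; at most [k.+2 ^ k.+2] tuples take
    all their values in [e]. *)
Lemma num_edge_tuples_leq (B W : {set V}) :
  (num_edge_tuples G (fun i => if i == ord0 then B else W)
     <= k.+2 ^ k.+2 * \sum_(v in B) degree_into W v)%N.
Proof.
rewrite /num_edge_tuples; set A := [set f | _].
pose D v := [set e in edges G | (v \in e) && (e \subset v |: W)].
pose T (e : {set V}) := [set f : {ffun 'I_k.+2 -> V} | f \in ffun_on (mem e)].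
have AS : A \subset \bigcup_(v in B) \bigcup_(e in D v) T e.
  apply/subsetP => f; rewrite inE => /andP[/forallP fX fE].
  have fi i : f i \in [set f i | i : 'I_k.+2] by apply: imset_f.
  apply/bigcupP; exists (f ord0); first exact: (fX ord0).
  apply/bigcupP; exists [set f i | i : 'I_k.+2]; last first.
    by rewrite inE; apply/ffun_onP => i; exact: fi.
  rewrite inE fE fi /=; apply/subsetP => _ /imsetP[i _ ->]; rewrite !inE.
  by have := fX i; case: (eqVneq i ord0) => [->|_ ->]; rewrite ?eqxx ?orbT.
apply: leq_trans (subset_leq_card AS) _; apply: leq_trans (card_bigcup_leq _ _) _.
rewrite big_distrr /=; apply: leq_sum => v _.
apply: leq_trans (card_bigcup_leq _ _) _.
rewrite /degree_into mulnC -/(D v) -sum_nat_const; apply: leq_sum => e.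
rewrite inE => /andP[eG _].
by rewrite cardsE card_ffun_on card_ord (edges_uniform eG).
Qed.

Lemma UniDen_low_degree (R : realType) (eps d c : R) (B W : {set V}) :
  UniDen eps d G -> (forall v, v \in B -> (degree_into W v)%:R <= c) ->
  d * #|B|%:R * #|W|%:R ^+ k.+1 - eps * #|V|%:R ^+ k.+2
    <= (k.+2 ^ k.+2)%:R * c * #|B|%:R.
Proof.
move=> /(_ (fun i => if i == ord0 then B else W)) dense Bc.
rewrite big_ord_recl /= prodr_const card_ord mulrA in dense.
apply: le_trans dense _.
apply: (@le_trans _ _ ((k.+2 ^ k.+2 * \sum_(v in B) degree_into W v)%N%:R)).
  by rewrite ler_nat num_edge_tuples_leq.
rewrite natrM -mulrA ler_wpM2l // natr_sum mulr_natr -sumr_const.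
exact: ler_sum.
Qed.

End UniformHypergraph.

(** * Passing to a vertex subset with thinned edges *)

Section InducedSubgraph.
Variables (k : nat) (V : finType) (G : kgraph k.+2 V) (W : {set V}).
Variable E' : {set {set V}}.
Hypothesis E'G : E' \subset edges G.

Let U : finType := {x : V | x \in W}.

Fact induced_uniform (e : {set U}) :
  e \in [set e : {set U} | val @: e \in E'] -> #|e| = k.+2.
Proof.
rewrite inE => /(subsetP E'G) /edges_uniform.
by rewrite card_imset //; apply: val_inj.
Qed.

(** Not always the full induced subgraph: [E'] may omit edges of [G], which later allows prescribing
    the edges at one vertex. *)
Definition induced : kgraph k.+2 U := KGraph induced_uniform.

Lemma degree_induced (x : U) :
  (#|[set e in E' | (val x \in e) && (e \subset W)]| <= degree induced x)%N.
Proof.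
rewrite /degree; set D := [set e in edges induced | _].
rewrite -(card_imset (mem D) (imset_inj val_inj)).
apply/subset_leq_card/subsetP => e; rewrite inE => /and3P[eE xe /subsetP eW].
have ee : e = val @: [set y : U | val y \in e].
  apply/setP => y; apply/idP/imsetP => [ye|[z + ->]]; last by rewrite inE.
  by exists (Sub y (eW y ye)); rewrite ?inE.
by apply/imsetP; exists [set y : U | val y \in e]; rewrite // !inE -ee eE xe.
Qed.

Lemma card_ffun_at (v : V) (i : 'I_k.+2) :
  (#|[set f : {ffun 'I_k.+2 -> V} | f i == v]| <= #|V| ^ k.+1)%N.
Proof.
rewrite -[k.+1 in X in (_ <= X)%N]card_ord -card_ffun.
pose r (f : {ffun 'I_k.+2 -> V}) := [ffun j : 'I_k.+1 => f (lift i j)].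
rewrite -(@card_in_imset _ _ r) ?max_card //.
move=> f g; rewrite !inE => /eqP fi /eqP gi /ffunP rfg; apply/ffunP => j.
case: (unliftP i j) => [l ->|->]; last by rewrite fi gi.
by have := rfg l; rewrite !ffunE.
Qed.

(** Edges avoiding [v] are all kept, so a tuple is lost only if some entry equals [v]; fixing the
    position of that entry leaves [k.+1] free ones. *)
Lemma num_edge_tuples_induced (v : U) (X : 'I_k.+2 -> {set U}) :
  (forall e, e \in edges G -> val v \notin e -> e \in E') ->
  (num_edge_tuples G (fun i => val @: X i)
     <= num_edge_tuples induced X + k.+2 * #|V| ^ k.+1)%N.
Proof.
move=> GE'; rewrite /num_edge_tuples; set A := [set f | _]; set B := [set f | _].
pose h (g : {ffun 'I_k.+2 -> U}) := [ffun i => val (g i)].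
pose C := \bigcup_(i < k.+2) [set f : {ffun 'I_k.+2 -> V} | f i == val v].
have AS : A \subset (h @: B) :|: C.
  apply/subsetP => f; rewrite inE => /andP[/forallP fX fE]; rewrite inE.
  have [/existsP[i fi]|] := boolP [exists i, f i == val v].
    by apply/orP; right; apply/bigcupP; exists i; rewrite ?inE.
  rewrite negb_exists => /forallP fv; apply/orP; left.
  (* The default [v] of [insubd] is never taken, since every [f i] lies in [W]. *)
  pose g := [ffun i => insubd v (f i) : U].
  have fg i : f i = val (g i).
    rewrite ffunE val_insubd; have /imsetP[y _ ->] := fX i.
    by rewrite (valP y).
  have gE : val @: [set g i | i : 'I_k.+2] = [set f i | i : 'I_k.+2].
    by rewrite -imset_comp; apply: eq_imset => i /=; rewrite fg.
  apply/imsetP; exists g; last by apply/ffunP => i; rewrite ffunE fg.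
  rewrite inE; apply/andP; split.
    apply/forallP => i; have /imsetP[y yX] := fX i.
    by rewrite fg => /val_inj ->.
  rewrite inE gE GE' //; apply/imsetP => -[i _ /eqP].
  by rewrite eq_sym (negbTE (fv i)).
apply: leq_trans (subset_leq_card AS) _.
apply: leq_trans (leq_card_setU _ _) _; apply: leq_add.
  exact: leq_imset_card.
apply: leq_trans (card_bigcup_leq _ _) _.
rewrite -[k.+2 in X in (_ <= X)%N]card_ord -sum_nat_const.
by apply: leq_sum => i _; apply: card_ffun_at.
Qed.

End InducedSubgraph.

(** As [W] has linear size and thinning at one vertex costs only [O(#|V| ^ k.+1)] tuples, the
    hypergraph on [W] with edges [E'] is again uniformly dense, and the covering property applies to
    it. *)
Lemma Cov_induced (R : realType) (k m : nat) (F : kgraph k.+2 'I_m) (d mu gamma : R) :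
  in_family R Cov F -> 0 < d -> 0 < mu -> 0 < gamma ->
  exists2 eps : R, 0 < eps & exists n0 : nat,
  forall (V : finType) (G : kgraph k.+2 V), (n0 <= #|V|)%N -> UniDen eps d G ->
  forall (W : {set V}) (v : V) (E' : {set {set V}}),
    gamma * #|V|%:R <= #|W|%:R -> (m %| #|W|)%N -> v \in W ->
    E' \subset edges G -> (forall e, e \in edges G -> v \notin e -> e \in E') ->
    (forall x, x \in W ->
       mu * #|V|%:R ^+ k.+1 <= #|[set e in E' | (x \in e) && (e \subset W)]|%:R) ->
  exists phi : {ffun 'I_m -> V},
    [/\ forall i, phi i \in W, mult v phi = 1%N
      & forall e, e \in edges F -> phi @: (e : {set 'I_m}) \in E'].
Proof.
move=> covF d0 mu0 g0.
have [eps1 eps10 [n1 covG]] := covF d mu d0 mu0.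
(* Two errors of size [eps * #|V| ^+ k.+2] fit into [eps1 * #|W| ^+ k.+2]: the density error of [G]
   and the tuples lost at [v]. *)
pose eps := eps1 * gamma ^+ k.+2 / 2.
have eps0 : 0 < eps by rewrite divr_gt0 // mulr_gt0 ?exprn_gt0.
exists eps => //.
exists (maxn (Num.bound (n1%:R / gamma)) (Num.bound (k.+2%:R / eps))) => V G.
rewrite geq_max => /andP[n1V kV] dense W v E' gW mW vW E'G GE' degE'.
have bound (a b : R) : 0 <= a -> 0 < b -> (Num.bound (a / b) <= #|V|)%N ->
    a <= b * #|V|%:R.
  move=> a0 b0 abV; rewrite mulrC -ler_pdivrMr // ltW //.
  apply: lt_le_trans (archi_boundP _) _; first by rewrite divr_ge0 // ltW.
  by rewrite ler_nat.
have {}n1V := bound _ _ (ler0n _ _) g0 n1V.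
have {}kV := bound _ _ (ler0n _ _) eps0 kV.
pose U : finType := {x : V | x \in W}.
pose v' : U := Sub v vW.
have cU : #|U| = #|W| by rewrite card_sig.
have [] := covG #|W| _ mW U (induced W E'G) cU _ _ v'.
- by rewrite -(ler_nat R) (le_trans n1V).
- move=> X; have := dense (fun i => val @: X i).
  under eq_bigr do rewrite (card_imset _ val_inj).
  move=> dX.
  have := @num_edge_tuples_induced _ _ G W E' E'G v' X GE'.
  rewrite -(ler_nat R) natrD natrM natrX => /(le_trans dX) {}dX.
  have W1 : (gamma * #|V|%:R) ^+ k.+2 <= (#|U|%:R : R) ^+ k.+2.
    rewrite cU ler_pXn2r // nnegrE ?ler0n // mulr_ge0 //; exact: ltW.
  have W2 : k.+2%:R * (#|V|%:R : R) ^+ k.+1 <= eps * #|V|%:R ^+ k.+2.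
    by rewrite [X in eps * X]exprS mulrA ler_wpM2r // exprn_ge0.
  have W3 : 2 * (eps * #|V|%:R ^+ k.+2) <= eps1 * #|U|%:R ^+ k.+2.
    have -> : 2 * (eps * #|V|%:R ^+ k.+2) = eps1 * (gamma * #|V|%:R) ^+ k.+2.
      by rewrite /eps exprMn; field.
    by rewrite ler_wpM2l // ltW.
  lra.
- move=> x; apply: (@le_trans _ _ (mu * #|V|%:R ^+ k.+1)).
    apply: ler_wpM2l; first exact: ltW.
    rewrite -natrX ler_nat /= cU.
    apply: leq_trans (bin_leq_expn _ _) _; rewrite leq_exp2r //.
    exact: leq_trans (leq_pred _) (max_card _).
  apply: le_trans (degE' _ (valP x)) _; rewrite ler_nat.
  exact: degree_induced.
move=> psi psiH psi1; exists [ffun i => val (psi i)]; split.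
- by move=> i; rewrite ffunE (valP (psi i)).
- rewrite -psi1; apply: eq_card => i; rewrite !inE ffunE.
  by rewrite -(inj_eq val_inj).
- move=> e eF; move: psiH; rewrite inE => /forallP/(_ e)/implyP/(_ eF).
  rewrite inE -imset_comp; congr (_ \in E'); apply: eq_imset => i /=.
  by rewrite ffunE.
Qed.

(** * Removing bad vertices while keeping density, degrees and divisibility *)

Lemma UniDen_le (R : realType) (eps eps' d : R) k (V : finType) (G : kgraph k V) :
  eps <= eps' -> UniDen eps d G -> UniDen eps' d G.
Proof.
move=> le_eps dense X; apply: le_trans (dense X).
by rewrite lerD2l lerN2 ler_wpM2r ?exprn_ge0.
Qed.

(** Density is tested on the exceptional set followed by copies of [W]. The threshold times
    [k.+2 ^ k.+2] is half of [d * (gamma * #|V|) ^+ k.+1], so low degrees account for at most half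
    of the main term; the error term must pay for the rest, which bounds the exceptional set. *)
Lemma few_low_degree (R : realType) (eps d gamma eta : R) k (V : finType)
    (G : kgraph k.+2 V) (W : {set V}) :
  0 < d -> 0 < gamma -> UniDen eps d G -> eps <= eta * (d * gamma ^+ k.+1 / 2) ->
  (0 < #|V|)%N -> gamma * #|V|%:R <= #|W|%:R ->
  #|[set w | (degree_into G W w)%:R
      < d * gamma ^+ k.+1 / (2 * (k.+2 ^ k.+2)%:R) * #|V|%:R ^+ k.+1]|%:R
    <= eta * #|V|%:R :> R.
Proof.
move=> d0 g0 dense le_eps V0 gW; set c := _ / _ * _; set B := [set w | _].
have n0 : 0 < #|V|%:R :> R by rewrite ltr0n.
have low v : v \in B -> (degree_into G W v)%:R <= c by rewrite inE => /ltW.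
have := UniDen_low_degree dense low.
have -> : (k.+2 ^ k.+2)%:R * c = d * gamma ^+ k.+1 / 2 * #|V|%:R ^+ k.+1.
  by rewrite /c; field; rewrite pnatr_eq0 expn_eq0.
set a := d * gamma ^+ k.+1 / 2 => main.
have a0 : 0 < a by rewrite divr_gt0 // mulr_gt0 ?exprn_gt0.
have WV : 2 * a * #|V|%:R ^+ k.+1 * #|B|%:R <= d * #|B|%:R * #|W|%:R ^+ k.+1.
  have -> : 2 * a * #|V|%:R ^+ k.+1 * #|B|%:R
            = d * #|B|%:R * (gamma * #|V|%:R) ^+ k.+1.
    by rewrite /a exprMn; field.
  apply: ler_wpM2l; first by rewrite mulr_ge0 // ltW.
  by rewrite ler_pXn2r // nnegrE ?mulr_ge0 // ltW.
have eV : eps * #|V|%:R ^+ k.+2 <= eta * a * #|V|%:R ^+ k.+2.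
  by rewrite ler_wpM2r // exprn_ge0.
have aV0 : 0 < a * #|V|%:R ^+ k.+1 by rewrite mulr_gt0 ?exprn_gt0.
rewrite -(ler_pM2l aV0).
have -> : a * #|V|%:R ^+ k.+1 * (eta * #|V|%:R) = eta * a * #|V|%:R ^+ k.+2.
  by rewrite [_ ^+ k.+2]exprSr; ring.
lra.
Qed.

Lemma subset_of_card (T : finType) (A : {set T}) (t : nat) :
  (t <= #|A|)%N -> exists2 B : {set T}, B \subset A & #|B| = t.
Proof.
move=> /card_geqP[s [us st sA]]; exists [set x in s].
  by apply/subsetP => x; rewrite inE => /sA.
by rewrite cardsE -st; apply/card_uniqP.
Qed.

(** The size is one less than the largest multiple of [m] up to [#|A|.+1]; the shift leaves room for
    one more vertex. *)
Lemma subset_of_card_mod (T : finType) (A : {set T}) (m : nat) :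
  (0 < m <= #|A|)%N ->
  exists2 B : {set T}, B \subset A & (m %| #|B|.+1)%N && (#|A| <= #|B| + m)%N.
Proof.
move=> /andP[m0 mA].
have q0 : (0 < #|A|.+1 %/ m)%N by rewrite divn_gt0 // leqW.
have E := divn_eq #|A|.+1 m; have M := ltn_pmod #|A|.+1 m0.
have P : (0 < #|A|.+1 %/ m * m)%N by rewrite muln_gt0 q0.
have [|B BA Bt] := @subset_of_card _ A (#|A|.+1 %/ m * m).-1; first by lia.
exists B => //; rewrite Bt prednK // dvdn_mull //=; lia.
Qed.

Lemma natr_large (R : realType) (a b : R) :
  0 < b -> exists n0 : nat, forall n, (n0 <= n)%N -> a <= b * n%:R.
Proof.
move=> b0; exists (Num.bound (`|a| / b)) => n; rewrite -(ler_nat R) => nb.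
apply: le_trans (ler_norm _) _; rewrite mulrC -ler_pdivrMr //.
by apply: le_trans nb; apply/ltW/archi_boundP; rewrite divr_ge0 // ltW.
Qed.

(** Dropping from [W] the vertices of low degree into it and at most [m] more restores minimum
    degree and divisibility. Edges avoiding [v] are all retained, so only the edges at [v] are
    restricted to [E']. *)
Lemma Cov_link (R : realType) (k m : nat) (F : kgraph k.+2 'I_m) (d mu gamma : R) :
  (0 < m)%N -> in_family R Cov F -> 0 < d -> 0 < mu -> 0 < gamma ->
  exists2 eps : R, 0 < eps & exists n0 : nat,
  forall (V : finType) (G : kgraph k.+2 V), (n0 <= #|V|)%N -> UniDen eps d G ->
  forall (W : {set V}) (v : V) (E' : {set {set V}}),
    gamma * #|V|%:R <= #|W|%:R -> E' \subset edges G ->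
    mu * #|V|%:R ^+ k.+1
      <= #|[set e in E' | (v \in e) && (e \subset v |: W)]|%:R ->
  exists phi : {ffun 'I_m -> V},
    [/\ forall i, phi i \in v |: W, mult v phi = 1%N, phi \in hom_digraph F G
      & forall e, e \in edges F -> v \in phi @: (e : {set 'I_m}) ->
          phi @: e \in E'].
Proof.
move=> m0 covF d0 mu0 g0.
pose beta : R := d * gamma ^+ k.+1 / (2 * (k.+2 ^ k.+2)%:R).
have beta0 : 0 < beta.
  by rewrite divr_gt0 ?mulr_gt0 ?exprn_gt0 // ltr0n expn_gt0.
pose nu : R := Num.min beta mu / 2.
have nu0 : 0 < nu by rewrite divr_gt0 // lt_min beta0.
have nubeta : 2 * nu <= beta by rewrite /nu mulrC divfK ?pnatr_eq0 // ge_min lexx.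
have numu : 2 * nu <= mu by rewrite /nu mulrC divfK ?pnatr_eq0 // ge_min lexx orbT.
(* At most [eta * #|V|] vertices are to be avoided: the bound [nu] lets the degrees survive, the
   bound [gamma / 2] keeps half of the guaranteed size of [W]. *)
pose eta : R := Num.min nu (gamma / 2).
have eta0 : 0 < eta by rewrite /eta lt_min nu0 divr_gt0.
have etanu : eta <= nu by rewrite /eta ge_min lexx.
have etag : eta <= gamma / 2 by rewrite /eta ge_min lexx orbT.
have g20 : 0 < gamma / 2 by rewrite divr_gt0.
have [eps1 eps10 [n1 covG]] := Cov_induced covF d0 nu0 g20.
(* Half of the budget [eta] goes to the vertices of low degree, the other half to [v] and the up to
   [m] vertices dropped for divisibility. *)
pose eps2 := eta / 2 * (d * gamma ^+ k.+1 / 2).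
have eps20 : 0 < eps2 by rewrite mulr_gt0 ?divr_gt0 ?mulr_gt0 ?exprn_gt0.
exists (Num.min eps1 eps2); first by rewrite lt_min eps10.
have [n2 large] := @natr_large R m.+1%:R (eta / 2) (divr_gt0 eta0 (ltr0n _ 2)).
exists (maxn n1 n2) => V G; rewrite geq_max => /andP[n1V /large {}large] dense.
have dense1 : UniDen eps1 d G by apply: UniDen_le dense; rewrite ge_min lexx.
have dense2 : UniDen eps2 d G by apply: UniDen_le dense; rewrite ge_min lexx orbT.
move=> W v E' gW E'G degv.
have V0 : (0 < #|V|)%N.
  rewrite lt0n; apply: contraTN large => /eqP->.
  by rewrite mulr0 -ltNge ltr0n.
have := few_low_degree d0 g0 dense2 (lexx _) V0 gW.
rewrite -/beta; set B := [set w | _] => cB.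
pose S := (W :\: B) :\ v.
have WS : (#|W| <= #|S| + #|B| + 1)%N.
  have : W \subset (S :|: B) :|: [set v].
    by apply/subsetP => x xW; rewrite !inE xW andbT; case: eqP; case: (_ < _).
  move=> /subset_leq_card WS; apply: leq_trans WS _.
  apply: leq_trans (leq_card_setU _ _) _; rewrite cards1 leq_add2r.
  exact: leq_card_setU.
have mS : (m <= #|S|)%N.
  move: WS; rewrite -(ler_nat R) !natrD -(ler_nat R) => WS.
  rewrite -natr1 in large; have m1 : 0 <= m%:R :> R by [].
  have : eta * #|V|%:R <= gamma / 2 * #|V|%:R by rewrite ler_wpM2r.
  lra.
have [W'' W''S /andP[mW'' SW'']] : exists2 B : {set V}, B \subset S &
    (m %| #|B|.+1)%N && (#|S| <= #|B| + m)%N.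
  by apply: subset_of_card_mod; rewrite m0.
have vW'' : v \notin W''.
  by apply: contraTN isT => /(subsetP W''S); rewrite !inE eqxx.
have W''W : W'' \subset W.
  by apply: subset_trans W''S _; apply: subset_trans (subD1set _ _) (subsetDl _ _).
pose W' := v |: W''.
have cW' : #|W'| = #|W''|.+1 by rewrite cardsU1 vW''.
(* Including [v] in [L] has a purpose: an edge of [G] at another vertex that misses [L] avoids [v],
   hence lies in [E''] whatever [E'] is. *)
pose L := v |: (W :\: W').
have cL : (#|L|%:R : R) <= eta * #|V|%:R.
  have : (#|L| <= 1 + (#|B| + m))%N.
    apply: leq_trans (leq_card_setU _ _) _; rewrite cards1 leq_add2l.
    have : W :\: W' \subset B :|: (S :\: W'').
      apply/subsetP => x; rewrite !inE negb_or => /andP[/andP[-> ->] ->].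
      by rewrite !andbT; case: (_ < _).
    move=> /subset_leq_card WB; apply: leq_trans WB _.
    apply: leq_trans (leq_card_setU _ _) _; rewrite leq_add2l cardsD.
    by rewrite (setIidPr W''S) leq_subLR.
  rewrite -(ler_nat R) !natrD => {}cL; rewrite -natr1 in large.
  lra.
pose E'' := E' :|: [set e in edges G | v \notin e].
have L_deg x : #|[set e in edges G | (x \in e) && ~~ [disjoint e & L :\ x]]|%:R
    <= nu * #|V|%:R ^+ k.+1 :> R.
  apply: (@le_trans _ _ (#|L|%:R * #|V|%:R ^+ k)).
    by rewrite -natrX -natrM ler_nat card_edges_meeting.
  rewrite exprS mulrA ler_wpM2r ?exprn_ge0 //.
  by apply: le_trans cL _; rewrite ler_wpM2r.
have deg_split (a : R) (x : V) (A C : {set {set V}}) :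
    2 * nu <= a -> a * #|V|%:R ^+ k.+1 <= #|A|%:R ->
    A \subset C :|: [set e in edges G | (x \in e) && ~~ [disjoint e & L :\ x]] ->
    nu * #|V|%:R ^+ k.+1 <= #|C|%:R.
  move=> na aA /subset_leq_card AC.
  have : (#|A| <= #|C| + #|[set e in edges G | (x \in e) && ~~ [disjoint e & L :\ x]]|)%N.
    by apply: leq_trans AC _; apply: leq_card_setU.
  rewrite -(ler_nat R) natrD; have := L_deg x.
  have : 2 * nu * #|V|%:R ^+ k.+1 <= a * #|V|%:R ^+ k.+1 by rewrite ler_wpM2r ?exprn_ge0.
  lra.
have E''G : E'' \subset edges G.
  by rewrite subUset E'G; apply/subsetP => e; rewrite inE => /andP[].
have [] := covG V G n1V dense1 W' v E'' _ _ _ E''G.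
- have : (#|W| <= #|W'| + #|L|)%N.
    apply: leq_trans (leq_card_setU _ _); apply/subset_leq_card/subsetP => x xW.
    by rewrite !inE xW; case: (x == v); case: (x \in W'').
  rewrite -(ler_nat R) natrD.
  have : eta * #|V|%:R <= gamma / 2 * #|V|%:R by rewrite ler_wpM2r.
  lra.
- by rewrite cW'.
- by rewrite setU11.
- by move=> e eG ve; rewrite inE orbC inE eG ve.
- move=> x; rewrite !inE => /predU1P[->|xW''].
    apply: (deg_split _ v _ _ numu degv); apply/subsetP => e.
    rewrite !inE => /and3P[eE' ve eW]; rewrite eE' ve (subsetP E'G _ eE') /=.
    rewrite orbC -implybE; apply/implyP => eL; apply/subsetP => y ye.
    have := disjointFr eL ye; have := subsetP eW y ye; rewrite !inE.
    by case: (y == v) => //= ->; rewrite andbT => /negbFE.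
  have : x \in S by apply: (subsetP W''S).
  rewrite !inE => /and3P[xv]; rewrite -leNgt => xB xW.
  apply: (deg_split _ x _ _ nubeta xB); apply/subsetP => e.
  rewrite !inE => /and3P[eG xe]; rewrite (setUidPr _) ?sub1set // => eW.
  rewrite eG xe /= orbC -implybE; apply/implyP => eL.
  have notL y : y \in e -> (y != x) -> y \notin L.
    by move=> ye yx; have := disjointFr eL ye; rewrite in_setD1 yx => /= ->.
  have ve : v \notin e.
    by apply/negP => /notL; rewrite eq_sym xv setU11 => /(_ isT).
  rewrite ve orbT /=; apply/subsetP => y ye; rewrite !inE.
  have [->|yx] := eqVneq y x; first by rewrite xW'' orbT.
  have := notL y ye yx; rewrite !inE (subsetP eW y ye) andbT.
  by case: eqP => //=; rewrite negbK.
move=> phi [phiW phi1 phiE]; exists phi; split => //.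
- move=> i; have := phiW i; rewrite !inE => /orP[->//|/(subsetP W''W) ->].
  by rewrite orbT.
- rewrite inE; apply/forallP => e; apply/implyP => /phiE.
  exact: (subsetP E''G).
- by move=> e /phiE; rewrite !inE => /orP[//|/andP[_ /negP]].
Qed.

(** * The lattice spanned by the edges of a digraph *)

Section HomLattice.
Variables (m : nat) (V : finType) (H : digraph m V).

(** The coefficients have the form used in [Div], which says that the all-ones vector lies in this
    lattice. *)
Definition edge_lattice (x : {ffun V -> int}) : Prop :=
  exists w : {ffun 'I_m -> V} -> int,
    forall v, \sum_(e in H) w e * (mult v e)%:Z = x v.

Definition delta (v : V) : {ffun V -> int} := [ffun x => (v == x)%:Z].

Lemma edge_lattice0 : edge_lattice 0.
Proof. by exists (fun=> 0) => v; rewrite big1 ?ffunE // => e _; rewrite mul0r. Qed.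

Lemma edge_latticeB x y : edge_lattice x -> edge_lattice y -> edge_lattice (x - y).
Proof.
move=> [w wx] [z zy]; exists (fun e => w e - z e) => v.
rewrite !ffunE -wx -zy -sumrB; apply: eq_bigr => e _; exact: mulrBl.
Qed.

Lemma edge_latticeD x y : edge_lattice x -> edge_lattice y -> edge_lattice (x + y).
Proof.
move=> Lx Ly; rewrite -[y]opprK; apply: (edge_latticeB Lx).
by rewrite -[- y]add0r; apply: edge_latticeB Ly; apply: edge_lattice0.
Qed.

Lemma edge_lattice_sum (I : finType) (P : pred I) (x : I -> {ffun V -> int}) :
  (forall i, P i -> edge_lattice (x i)) -> edge_lattice (\sum_(i | P i) x i).
Proof.
move=> Lx; apply: big_ind => //; first exact: edge_lattice0.
exact: edge_latticeD.
Qed.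

Lemma edge_latticeMn x n : edge_lattice x -> edge_lattice (x *+ n).
Proof.
by move=> Lx; elim: n => [|n IHn]; rewrite ?mulrS; [apply: edge_lattice0 | apply: edge_latticeD].
Qed.

Lemma edge_lattice_edge e : e \in H -> edge_lattice (\sum_i delta (e i)).
Proof.
move=> eH; exists (fun f => (f == e)%:Z) => v.
rewrite (bigD1 e) //= eqxx mul1r big1 => [|f /andP[_ /negbTE->]]; last by rewrite mul0r.
rewrite addr0 sum_ffunE -natz /mult -sum1_card natr_sum.
rewrite [RHS](eq_bigr (fun i => (e i == v)%:Z)) => [|i _]; last by rewrite ffunE.
by rewrite big_mkcond; apply: eq_bigr => i _; rewrite inE; case: eqP.
Qed.

Lemma mult1P (v : V) (e : {ffun 'I_m -> V}) :
  mult v e = 1%N -> exists i0, forall i, (e i == v) = (i == i0).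
Proof.
move=> /eqP/cards1P[i0 /setP ei0]; exists i0 => i.
by have := ei0 i; rewrite !inE.
Qed.

(** The two tuples differ in a single position, where one has [v] and the other [u]. *)
Lemma edge_lattice_swap (u v : V) (e : {ffun 'I_m -> V}) :
  e \in H -> [ffun i => if e i == v then u else e i] \in H -> mult v e = 1%N ->
  edge_lattice (delta v - delta u).
Proof.
move=> eH fH /mult1P[i0 ei0].
have := edge_latticeB (edge_lattice_edge eH) (edge_lattice_edge fH).
rewrite -sumrB (bigD1 i0) //= big1 => [|i /negbTE ii0].
  by rewrite addr0 ffunE ei0 eqxx; have /eqP-> : e i0 == v by rewrite ei0.
by rewrite ffunE ei0 ii0 subrr.
Qed.

(** The [m.-1] entries other than the single [v] lie in [W], so each may be exchanged for [u] modulo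
    the lattice. *)
Lemma edge_lattice_replace (u v : V) (W : {set V}) (e : {ffun 'I_m -> V}) :
  (forall x, x \in W -> edge_lattice (delta x - delta u)) ->
  e \in H -> (forall i, e i \in v |: W) -> mult v e = 1%N ->
  edge_lattice (delta v + delta u *+ m.-1).
Proof.
move=> Wu eH eW /mult1P[i0 ei0].
have -> : delta v + delta u *+ m.-1
    = \sum_i delta (e i) - \sum_(i | i != i0) (delta (e i) - delta u).
  rewrite sumrB sumr_const (bigD1 i0) //= opprB.
  have -> : #|[pred i | i != i0]| = m.-1 by rewrite cardC1 card_ord.
  have /eqP-> : e i0 == v by rewrite ei0.
  by rewrite -addrA [X in _ = _ + X]addrC subrK.
apply: edge_latticeB; first exact: edge_lattice_edge.
apply: edge_lattice_sum => i ii0; apply: Wu.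
by have := eW i; rewrite !inE ei0 (negbTE ii0).
Qed.

(** With [#|V| = q * m], the all-ones vector is the sum of all [delta v - delta u] plus [q] copies
    of [delta u *+ m]. *)
Lemma edge_lattice_Div (u : V) :
  (m %| #|V|)%N -> edge_lattice (delta u *+ m) ->
  (forall v, edge_lattice (delta v - delta u)) -> Div H.
Proof.
move=> /dvdnP[q qm] Lm Luv.
have [w wE] : edge_lattice (\sum_v (delta v - delta u) + delta u *+ m *+ q).
  by apply: edge_latticeD; [apply: edge_lattice_sum | apply: edge_latticeMn].
exists w => v; rewrite wE sumrB sumr_const -mulrnA mulnC -qm subrK sum_ffunE.
rewrite (bigD1 v) //= ffunE eqxx big1 ?addr0 // => x /negbTE xv.
by rewrite ffunE xv.
Qed.

End HomLattice.

(** * Dense set families with many large pairwise intersections *)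

(* Second moment: [sum_t (deg t - a |I|)^2 >= 0], where [deg t] counts the
   [i] with [t \in A i], bounds the sum of all [|A i :&: A j|] from below. *)
Lemma exists_large_intersections (R : realType) (T I : finType) (P : {set T})
    (A : I -> {set T}) (a N : R) :
  0 < a -> 0 < N -> (0 < #|I|)%N -> #|P|%:R <= N ->
  (forall i, A i \subset P) -> (forall i, a * N <= #|A i|%:R) ->
  exists i, a ^+ 2 / 2 * #|I|%:R
    <= #|[set j | a ^+ 2 / 2 * N <= #|A i :&: A j|%:R]|%:R.
Proof.
move=> a0 N0 I0 PN AP aA.
pose chi i t : R := (t \in A i)%:R.
have card_chi i : #|A i|%:R = \sum_(t in P) chi i t.
  rewrite -sum1_card natr_sum big_mkcond [RHS]big_mkcond /=; apply: eq_bigr => t _.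
  rewrite /chi; have := subsetP (AP i) t.
  by case: (t \in A i) => [->|_] //; case: ifP.
have card_chi2 i j : #|A i :&: A j|%:R = \sum_(t in P) chi i t * chi j t.
  rewrite -sum1_card natr_sum big_mkcond [RHS]big_mkcond /=; apply: eq_bigr => t _.
  rewrite /chi inE; have := subsetP (AP i) t.
  case: (t \in A i) => [->|_] //; rewrite ?mul1r ?mul0r ?if_same //.
  by case: (t \in A j).
set n : R := #|I|%:R.
have n0 : 0 < n by rewrite ltr0n.
pose deg t := \sum_i chi i t.
have sum1 : n * (a * N) <= \sum_(t in P) deg t.
  rewrite exchange_big /= -(eq_bigr _ (fun i _ => card_chi i)).
  rewrite mulrC mulr_natr -sumr_const; exact: ler_sum.
have sum2 : \sum_(t in P) deg t ^+ 2 = \sum_i \sum_j #|A i :&: A j|%:R.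
  under [RHS]eq_bigr do under eq_bigr do rewrite card_chi2.
  under [RHS]eq_bigr do rewrite exchange_big /=.
  rewrite exchange_big /=; apply: eq_bigr => t _.
  rewrite expr2 mulr_suml; apply: eq_bigr => i _; exact: mulr_sumr.
have total : a ^+ 2 * N * n ^+ 2 <= \sum_i \sum_j #|A i :&: A j|%:R.
  have : 0 <= \sum_(t in P) (deg t - a * n) ^+ 2.
    by apply: sumr_ge0 => t _; apply: sqr_ge0.
  have -> : \sum_(t in P) (deg t - a * n) ^+ 2
      = \sum_(t in P) deg t ^+ 2 - 2 * (a * n) * \sum_(t in P) deg t
        + (a * n) ^+ 2 * #|P|%:R.
    rewrite mulr_natr -sumr_const mulr_sumr -sumrB -big_split /=.
    by apply: eq_bigr => t _; ring.
  have P1 : (a * n) ^+ 2 * #|P|%:R <= (a * n) ^+ 2 * N by rewrite ler_wpM2l ?sqr_ge0.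
  have D1 : 2 * (a * n) * (n * (a * N)) <= 2 * (a * n) * \sum_(t in P) deg t.
    by rewrite ler_wpM2l // mulr_ge0 // mulr_ge0 // ltW.
  rewrite -sum2; lra.
have [i iE] : exists i, a ^+ 2 * N * n <= \sum_j #|A i :&: A j|%:R.
  apply/existsP; apply: contraLR isT; rewrite negb_exists => /forallP small.
  suff : \sum_i \sum_j #|A i :&: A j|%:R < a ^+ 2 * N * n ^+ 2 by rewrite ltNge total.
  have -> : a ^+ 2 * N * n ^+ 2 = \sum_(i : I) a ^+ 2 * N * n.
    by rewrite sumr_const -mulr_natr -/n; ring.
  have [i0 _] := card_gt0P I0.
  apply: ltr_sum => [|i _]; last by rewrite ltNge small.
  by apply/hasP; exists i0; rewrite ?mem_index_enum.
exists i; set X := [set j | _].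
(* An index in [X] contributes at most [N], any other at most [a ^+ 2 / 2 * N]. As the sum is at
   least [a ^+ 2 * N * n], the indices in [X] supply at least half of that. *)
have : \sum_j #|A i :&: A j|%:R <= #|X|%:R * N + n * (a ^+ 2 / 2 * N).
  apply: (@le_trans _ _ (\sum_j ((j \in X)%:R * N + a ^+ 2 / 2 * N))).
    apply: ler_sum => j _; have [jX|] := boolP (j \in X).
      rewrite mul1r; apply: ler_wpDr; first by rewrite mulr_ge0 ?divr_ge0 ?sqr_ge0 // ltW.
      apply: le_trans PN; rewrite ler_nat; apply: subset_leq_card.
      exact: subset_trans (subsetIl _ _) (AP i).
    by rewrite inE -ltNge mul0r add0r => /ltW.
  rewrite big_split /= sumr_const -mulr_suml -natr_sum -big_mkcond sum1_card.
  by rewrite [X in _ <= _ + X]mulrC mulr_natr.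
by move=> sumX; rewrite -(ler_pM2r N0); lra.
Qed.

(** * Links and the exchange of two vertices *)

Section Links.
Variables (k : nat) (V : finType) (G : kgraph k.+2 V).

Definition link (v : V) : {set {set V}} :=
  [set S : {set V} | (v \notin S) && (v |: S \in edges G)].

Lemma link_uniform (v : V) : link v \subset [set S : {set V} | #|S| == k.+1].
Proof.
apply/subsetP => S; rewrite !inE => /andP[vS /edges_uniform].
by rewrite cardsU1 vS => /eqP.
Qed.

Lemma degree_leq_link (v : V) : (degree G v <= #|link v|)%N.
Proof.
rewrite /degree -(@card_in_imset _ _ (fun e : {set V} => e :\ v)).
  apply/subset_leq_card/subsetP => _ /imsetP[e + ->].
  by rewrite !inE eqxx => /andP[eG ve]; rewrite setD1K.
move=> e f; rewrite !inE => /andP[_ ve] /andP[_ vf] ef.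
by rewrite -(setD1K ve) ef setD1K.
Qed.

(** By uniformity such an edge contains [v]: otherwise [u |: e :\ v] would have one vertex too many.
    For [u != v] these edges correspond to the sets in the common link of [u] and [v]. *)
Definition exchangeable_edges (u v : V) : {set {set V}} :=
  [set e in edges G | (u \notin e) && (u |: e :\ v \in edges G)].

Lemma card_exchangeable_edges (u v : V) :
  u != v -> (#|link u :&: link v|
    <= #|[set e in exchangeable_edges u v | (v \in e) && (e \subset v |: setT)]|)%N.
Proof.
move=> uv; rewrite -(@card_in_imset _ _ (fun S : {set V} => v |: S)).
  apply/subset_leq_card/subsetP => _ /imsetP[S + ->].
  rewrite !inE => /andP[/andP[uS uE] /andP[vS vE]].
  by rewrite vE eqxx (negbTE uv) uS setU1K // uE setUT subsetT.
move=> S S'; rewrite !inE => /andP[_ /andP[vS _]] /andP[_ /andP[vS' _]] SS'.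
by rewrite -(setU1K vS) SS' setU1K.
Qed.

(** An edge of [F] whose image misses [v] keeps its image; any other image has [v] replaced by [u]
    and stays an edge by exchangeability. *)
Lemma exchange_hom m (F : kgraph k.+2 'I_m) (u v : V) (phi : {ffun 'I_m -> V}) :
  phi \in hom_digraph F G ->
  (forall e, e \in edges F -> v \in phi @: (e : {set 'I_m}) ->
    phi @: e \in exchangeable_edges u v) ->
  [ffun i => if phi i == v then u else phi i] \in hom_digraph F G.
Proof.
rewrite !inE => /forallP phiG phiE; set psi := finfun _.
apply/forallP => e; apply/implyP => eF.
have [ve|ve] := boolP (v \in phi @: e); last first.
  have -> : psi @: e = phi @: e.
    apply: eq_in_imset => i ie; rewrite ffunE; case: eqP => // pv.
    by rewrite -pv imset_f in ve.
  exact: implyP (phiG e) eF.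
have := phiE e eF ve; rewrite !inE => /and3P[_ _].
suff -> : psi @: e = u |: phi @: e :\ v by [].
apply/esym/setP => x; apply/idP/imsetP.
  rewrite !inE => /orP[/eqP->|/andP[xv /imsetP[i ie xi]]].
    by have /imsetP[i ie vi] := ve; exists i => //; rewrite ffunE -vi eqxx.
  by exists i => //; rewrite ffunE -xi (negbTE xv).
move=> [i ie ->]; rewrite ffunE !inE; case: ifP => [_|-> /=]; first by rewrite eqxx.
by rewrite imset_f ?orbT.
Qed.

End Links.

(** * Equivalence of all vertices modulo the lattice, and the all-ones vector *)

Theorem proposition4p17 (R : realType) (k m : nat) (hk : (2 <= k)%N)
    (F : kgraph k 'I_m) :
  in_family R Cov F -> in_family R Div F.
Proof.
case: k hk F => [|[|k]] // _ F covF d mu d0 mu0.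
(* Divisibility by [m = 0] forces [V] to be empty, so there is no vertex to check. *)
have [m0|m0] := posnP m.
  exists 1 => //; exists 0%N => n _ mn V G Vn _ _.
  exists (fun=> 0) => v; move: mn; rewrite [X in (X %| _)%N]m0 dvd0n -Vn => /eqP V0.
  by have := fintype0 v V0.
(* The constant of [expn_leq_bin]: every vertex then has degree at least [a * #|V| ^+ k.+1]. *)
pose C := (2 ^ k.+1 * k.+1`!)%N.
have C0 : 0 < C%:R :> R by rewrite ltr0n muln_gt0 expn_gt0 fact_gt0.
pose a : R := mu / C%:R.
have a0 : 0 < a by rewrite divr_gt0.
pose gamma : R := a ^+ 2 / 2.
have g0 : 0 < gamma by rewrite divr_gt0 ?exprn_gt0.
pose beta : R := d * gamma ^+ k.+1 / (2 * (k.+2 ^ k.+2)%:R).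
have beta0 : 0 < beta.
  by rewrite divr_gt0 ?mulr_gt0 ?exprn_gt0 // ltr0n expn_gt0.
have a20 : 0 < a / 2 by rewrite divr_gt0.
have half0 : 0 < 2^-1 :> R by rewrite invr_gt0.
(* [B] will have at most [eta * #|V|] vertices: [a / 2] limits the edges lost by avoiding [B] to
   half of the guaranteed degree, [gamma / 2] leaves a vertex of [X] outside [B], and [2^-1] leaves
   half of all vertices outside [B]. *)
pose eta : R := Num.min (Num.min (a / 2) (gamma / 2)) 2^-1.
have eta0 : 0 < eta by rewrite /eta !lt_min a20 divr_gt0.
have etaa : eta <= a / 2 by rewrite /eta !ge_min lexx.
have etag : eta <= gamma / 2 by rewrite /eta !ge_min lexx orbT.
have etah : eta <= 2^-1 by rewrite /eta !ge_min lexx !orbT.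
(* Used in turn for exchanging [v] with [u] inside all of [V], for degrees into [X], and for degrees
   into the complement of [B]. *)
have [eps1 eps10 [n1 cov1]] := Cov_link m0 covF d0 g0 ltr01.
have [eps2 eps20 [n2 cov2]] := Cov_link m0 covF d0 beta0 g0.
have [eps3 eps30 [n3 cov3]] := Cov_link m0 covF d0 a20 half0.
pose eps4 : R := eta * (d * gamma ^+ k.+1 / 2).
have eps40 : 0 < eps4 by rewrite mulr_gt0 // divr_gt0 // mulr_gt0 ?exprn_gt0.
exists (Num.min (Num.min eps1 eps2) (Num.min eps3 eps4)).
  by rewrite !lt_min eps10 eps20 eps30.
exists (maxn (maxn n1 n2) (maxn n3 (k.+1.*2))) => n.
rewrite !geq_max => /andP[/andP[n1n n2n] /andP[n3n kn]] mn V G Vn dense degG.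
rewrite -{}Vn {n} in n1n n2n n3n kn mn.
have dense1 : UniDen eps1 d G by apply: UniDen_le dense; rewrite !ge_min lexx.
have dense2 : UniDen eps2 d G by apply: UniDen_le dense; rewrite !ge_min lexx ?orbT.
have dense3 : UniDen eps3 d G by apply: UniDen_le dense; rewrite !ge_min lexx ?orbT.
have dense4 : UniDen eps4 d G by apply: UniDen_le dense; rewrite !ge_min lexx ?orbT.
have V0 : (0 < #|V|)%N by apply: leq_trans kn; rewrite doubleS.
have nV0 : 0 < #|V|%:R :> R by rewrite ltr0n.
have N0 : 0 < #|V|%:R ^+ k.+1 :> R by rewrite exprn_gt0.
have deg_ge v : a * #|V|%:R ^+ k.+1 <= (degree G v)%:R.
  apply: le_trans (degG v); rewrite /a -mulrA ler_pM2l // ler_pdivrMl //.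
  by rewrite -natrX -natrM ler_nat expn_leq_bin.
have [] := @exists_large_intersections R _ V [set S : {set V} | #|S| == k.+1]
  (link G) a (#|V|%:R ^+ k.+1) a0 N0 V0.
- by rewrite card_draws -natrX ler_nat bin_leq_expn.
- exact: link_uniform.
- by move=> v; apply: le_trans (deg_ge v) _; rewrite ler_nat degree_leq_link.
rewrite -/gamma => u; set X := [set v | _] => cX.
pose L := edge_lattice (hom_digraph F G).
have LX v : v \in X -> L (delta v - delta u).
  rewrite inE => codeg; have [->|uv] := eqVneq v u.
    by rewrite subrr; apply: edge_lattice0.
  have [|||phi [_ phi1 phiH phiE]] := cov1 V G n1n dense1 setT v (exchangeable_edges G u v).
  - by rewrite mul1r cardsT.
  - by apply/subsetP => e; rewrite inE => /andP[].
  - by apply: le_trans codeg _; rewrite ler_nat card_exchangeable_edges // eq_sym.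
  exact: edge_lattice_swap phiH (exchange_hom phiH phiE) phi1.
have cC := few_low_degree d0 g0 dense4 (lexx _) V0 cX.
rewrite -/beta in cC; set B := [set w | _] in cC.
have LB v : v \notin B -> L (delta v + delta u *+ m.-1).
  rewrite inE -leNgt => degv.
  have [|phi [phiX phi1 phiH _]] := cov2 V G n2n dense2 X v (edges G) cX _ degv; first exact: subxx.
  exact: edge_lattice_replace LX phiH phiX phi1.
(* For [x] in [X] outside [B], subtracting [delta x - delta u] from [delta x + delta u *+ m.-1]
   leaves [delta u *+ m]. *)
have Lm : L (delta u *+ m).
  have [x xX xB] : exists2 x, x \in X & x \notin B.
    apply/subsetPn; apply: contraTN cX => /subset_leq_card XB.
    rewrite -ltNge; apply: (@le_lt_trans _ _ #|B|%:R); first by rewrite ler_nat.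
    apply: le_lt_trans cC _; rewrite ltr_pM2r //; lra.
  have := edge_latticeB (LB x xB) (LX x xX).
  by rewrite opprB addrC addrA subrK -mulrS prednK.
(* Modulo [delta u *+ m], the term [delta u *+ m.-1] equals [- delta u]. *)
have {}LB v : v \notin B -> L (delta v - delta u).
  move=> /LB/edge_latticeB/(_ Lm).
  by rewrite -[in delta u *+ m](prednK m0) mulrS opprD addrA addrAC addrK.
apply: (edge_lattice_Div mn Lm) => v.
have [||phi [phiX phi1 phiH _]] := cov3 V G n3n dense3 (~: B) v (edges G) _ (subxx _).
- rewrite cardsCs setCK natrB ?max_card //.
  have : eta * #|V|%:R <= 2^-1 * #|V|%:R by rewrite ler_pM2r.
  lra.
(* Edges at [v] that meet [B] in another vertex number at most [#|B| * #|V| ^ k], half of the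
   guaranteed degree; the others count towards the degree into [~: B], even when [v] is in [B]. *)
- have low : #|[set e in edges G | (v \in e) && ~~ [disjoint e & B :\ v]]|%:R
      <= a / 2 * #|V|%:R ^+ k.+1.
    apply: (@le_trans _ _ (#|B|%:R * #|V|%:R ^+ k)).
      by rewrite -natrX -natrM ler_nat card_edges_meeting.
    rewrite exprS mulrA ler_wpM2r ?exprn_ge0 //.
    by apply: le_trans cC _; rewrite ler_pM2r.
  set D := [set e in edges G | (v \in e) && (e \subset _)].
  have : (degree G v <= #|D| + #|[set e in edges G | (v \in e) && ~~ [disjoint e & B :\ v]]|)%N.
    apply: leq_trans (leq_card_setU _ _); apply/subset_leq_card/subsetP => e.
    rewrite !inE => /andP[-> ->] /=; rewrite orbC -implybE; apply/implyP => eB.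
    apply/subsetP => y ye; have := disjointFr eB ye; rewrite !inE.
    by case: (y == v) => //= ->.
  rewrite -(ler_nat R) natrD; have := deg_ge v; lra.
have : L (delta v + delta u *+ m.-1).
  by apply: edge_lattice_replace phiH phiX phi1 => x; rewrite inE; apply: LB.
move=> /edge_latticeB/(_ Lm).
by rewrite -[in delta u *+ m](prednK m0) mulrS opprD addrA addrAC addrK.
Qed.
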